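(* Let $F$, $\theta$, $\psi=1-\theta$, $(r_k)$, $(y_k)$, $(z_k)$, $\gamma,\sigma\ge 1$ satisfy the standing assumption (A) of the context. Assume moreover that $F:\mathbb{R}^d\to\mathbb{R}^d$ is continuous and that $F-I$ is a uniform $P$-map with a modulus $h$ satisfying $h(t)\ge t^\beta$ for all $t\geq 0$, for some $\beta>1$. Let $x_*$ be the solution of $F(x)=|x|$, let $y_*=x_*^+$ be the corresponding solution of the complementarity problem $H(y)=F(y-H(y))-y$, $0\le y\perp H(y)\ge0$, where $H(y)=y-(F+I)^{-1}(2y)$ for $y\in\mathbb{R}^d$, and set $x_k=y_k-z_k$. Then $y_k\to y_*$, $z_k\to H(y_* )$ and $x_k\to x_*=y_*-H(y_* )$ as $k\to\infty$, with the estimates $$\|y_*-y_k\|\le O(r_k^{\alpha})\qquad\text{and}\qquad \|x_*-x_k\|\le O(r_k^{\tilde\sigma/\beta}),$$ where $\tilde\sigma=\min\{2,\sigma,\tfrac{\gamma}{\beta-1}\}$ and $\alpha=\min\{\tfrac{\tilde\sigma}{\beta},\tfrac{\tilde\sigma}{2}\}$.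
   Context: Notation: $|x|$ and $x^+=\max\{x,0\}$, $x^-=\max\{-x,0\}$ are coordinatewise; $I$ is the identity; $\|\cdot\|$ is the Euclidean norm; superscripts $i$ denote coordinates; $0\le y\perp z\ge 0$ means $y,z\in\mathbb{R}^d_+$ and $y^jz^j=0$ for all $j$. $O(\cdot)$ is with constants independent of $k$ (and of the coordinate). A map $G:\mathbb{R}^d\to\mathbb{R}^d$ is a $P_0$-map if for all $x\ne y$, $\max_{i:\,x^i\ne y^i}(x^i-y^i)(G(x)^i-G(y)^i)\ge0$. Given $h:\mathbb{R}_+\to\mathbb{R}_+$ with $h(0)=0<h(t)$ for $t>0$, $G$ is a uniform $P$-map with modulus $h$ if $\max_{1\le i\le d}(x^i-y^i)(G(x)^i-G(y)^i)\ge h(\|x-y\|)$ for all $x,y$. A smoothing function is a smooth (continuously differentiable), concave, increasing function $\theta:\mathbb{R}\to(-\infty,1)$ with $\theta(t)<0$ for $t<0$, $\theta(0)=0$, $\lim_{t\to+\infty}\theta(t)=1$. The function $\theta_1$ is $\theta_1(t)=\frac{t}{t+1}$ for $t\ge0$, $\theta_1(t)=t$ for $t\le 0$, and $\psi_1=1-\theta_1$. For $r>0$ and $y,z\in\mathbb{R}^d$, $G_r(y,z)\in\mathbb{R}^d$ has coordinates $G_r(y,z)^i=r\,\psi^{-1}\big(\psi(y^i/r)+\psi(z^i/r)\big)$ with $\psi=1-\theta$. Assumption (A): (a) $F:\mathbb{R}^d\to\mathbb{R}^d$ is such that the equation $F(x)=|x|$ has at least one solution and $F$ is $C^1$ in a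 neighborhood of the solution; $F-I$ is a $P_0$-map. (b) $\theta$ is a smoothing function such that $\psi=1-\theta$ satisfies $\psi\le\psi_1$ and: there exist $a\in(0,1)$ and $R_a>0$ with $\frac{\psi(t)}{2}\ge\psi(\frac{t}{a})$ for all $t\in(R_a,+\infty)$. (c) $(r_k)_{k\in\mathbb{N}}$ is a sequence of positive reals converging to $0$, and $(y_k)_{k\in\mathbb N},(z_k)_{k\in\mathbb N}$ are sequences of vectors in $\mathbb{R}^d$ with nonnegative coordinates such that $\|z_k-F(y_k-z_k)+y_k\|\le\varepsilon_k^{(1)}$ and $G_{r_k}(y_k,z_k)\le\varepsilon_k^{(2)}$ (componentwise), where $\varepsilon_k^{(1)}=O(r_k^\gamma)$, $\varepsilon_k^{(2)}=O(r_k^\sigma)$ with $\gamma,\sigma\ge1$. Under the hypotheses on $F$ in the claim, $F+I:\mathbb{R}^d\to\mathbb{R}^d$ is a homeomorphism, so $H$ is well defined. *)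

(* Defs.v *)
From HB Require Import structures.
From mathcomp Require Export all_boot all_order all_algebra.
From mathcomp Require Export all_classical all_reals all_analysis.
Export numFieldNormedType.Exports.
Export Order.TTheory GRing.Theory Num.Theory.

Set Implicit Arguments.
Unset Strict Implicit.
Unset Printing Implicit Defensive.

#[export] Set Implicit Arguments.

#[global] Open Scope classical_set_scope.
#[global] Open Scope ring_scope.

(* R^d is 'rV[R]_d with its library topology.  The library norm on matrices is
   the sup norm, so the Euclidean norm is defined separately. *)
Definition enorm {R : realType} {d : nat} (x : 'rV[R]_d) : R :=
  Num.sqrt (\sum_(i < d) x 0 i ^+ 2).

Definition absv {R : realType} {d : nat} (x : 'rV[R]_d) : 'rV[R]_d :=
  map_mx (fun t => `|t|) x.

Definition posv {R : realType} {d : nat} (x : 'rV[R]_d) : 'rV[R]_d :=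
  map_mx (fun t => Num.max t 0) x.

Definition nonneg {R : realType} {d : nat} (x : 'rV[R]_d) : Prop :=
  forall i, 0 <= x 0 i.

Definition complementary {R : realType} {d : nat} (y z : 'rV[R]_d) : Prop :=
  [/\ nonneg y, nonneg z & forall j, y 0 j * z 0 j = 0].

(* The finite maxima are taken in the extended reals, where the unit -oo of
   maxe is the maximum of the empty family. *)
Definition P0_map {R : realType} {d : nat} (G : 'rV[R]_d -> 'rV[R]_d) : Prop :=
  forall x y : 'rV[R]_d, x != y ->
    (0%:E <= \big[maxe/-oo%E]_(i < d | (x 0 i != y 0 i)%R)
       ((x 0 i - y 0 i) * (G x 0 i - G y 0 i))%R%:E)%E.

Definition modulus {R : realType} (h : R -> R) : Prop :=
  h 0 = 0 /\ forall t : R, 0 < t -> 0 < h t.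

Definition uniform_P_map {R : realType} {d : nat} (h : R -> R)
    (G : 'rV[R]_d -> 'rV[R]_d) : Prop :=
  modulus h /\
  forall x y : 'rV[R]_d,
    ((h (enorm (x - y)))%:E <= \big[maxe/-oo%E]_(i < d)
       ((x 0 i - y 0 i) * (G x 0 i - G y 0 i))%R%:E)%E.

Definition C1_near {R : realType} {d : nat} (F : 'rV[R]_d -> 'rV[R]_d)
    (p : 'rV[R]_d) : Prop :=
  \forall x \near p, differentiable F x /\ {for x, continuous (jacobian F)}.

Record smoothing_function {R : realType} (theta : R -> R) : Prop := {
  smoothing_derivable : forall t : R, derivable theta t 1;
  smoothing_derive1_continuous : continuous (theta^`()%classic);
  smoothing_concave : convex_function setT (fun t => - theta t);
  smoothing_increasing : {homo theta : s t / s < t};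
  smoothing_lt1 : forall t, theta t < 1;
  smoothing_lt0 : forall t : R, t < 0 -> theta t < 0;
  smoothing_0 : theta 0 = 0;
  smoothing_cvg : theta t @[t --> +oo] --> (1 : R)
}.

Definition psi_of {R : realType} (theta : R -> R) (t : R) : R := 1 - theta t.

Definition theta1 {R : realType} (t : R) : R :=
  if 0 <= t then t / (t + 1) else t.

(* pinv setT f is the library's total inverse function: it is a right inverse of
   f on the range of f, and f^-1 when f is bijective. For a
   smoothing function, psi is a bijection from R to ]0, +oo[. *)
Definition Gr {R : realType} {d : nat} (theta : R -> R) (r : R)
    (y z : 'rV[R]_d) : 'rV[R]_d :=
  let psi := psi_of theta in
  \row_i (r * pinv setT psi (psi (y 0 i / r) + psi (z 0 i / r))).

Definition Hmap {R : realType} {d : nat} (F : 'rV[R]_d -> 'rV[R]_d)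
    (y : 'rV[R]_d) : 'rV[R]_d :=
  y - pinv setT (fun x : 'rV[R]_d => F x + x) (2 *: y).

Record assumption_a {R : realType} {d : nat} (F : 'rV[R]_d -> 'rV[R]_d) :
    Prop := {
  a_solvable : exists x, F x = absv x;
  a_C1 : forall x, F x = absv x -> C1_near F x;
  a_P0 : P0_map (fun x : 'rV[R]_d => F x - x)
}.

Record assumption_b {R : realType} (theta : R -> R) : Prop := {
  b_smoothing : smoothing_function theta;
  b_le_psi1 : forall t, psi_of theta t <= psi_of theta1 t;
  b_decay : exists a Ra : R, [/\ 0 < a < 1, 0 < Ra &
    forall t, Ra < t -> psi_of theta (t / a) <= psi_of theta t / 2]
}.

Record assumption_c {R : realType} {d : nat} (F : 'rV[R]_d -> 'rV[R]_d)
    (theta : R -> R) (r : nat -> R) (y z : nat -> 'rV[R]_d)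
    (gamma sigma : R) : Prop := {
  c_r_gt0 : forall k, 0 < r k;
  c_r_cvg : r k @[k --> \oo] --> (0 : R);
  c_y_ge0 : forall k, nonneg (y k);
  c_z_ge0 : forall k, nonneg (z k);
  c_gamma : 1 <= gamma;
  c_sigma : 1 <= sigma;
  c_eps1 : exists eps1 : nat -> R,
    eps1 =O_\oo (fun k => r k `^ gamma) /\
    forall k, enorm (z k - F (y k - z k) + y k) <= eps1 k;
  c_eps2 : exists eps2 : nat -> 'rV[R]_d,
    (forall i, (fun k => eps2 k 0 i) =O_\oo (fun k => r k `^ sigma)) /\
    forall k i, Gr theta (r k) (y k) (z k) 0 i <= eps2 k 0 i
}.

(* Main.v *)
From mathcomp Require Import ring lra.
Require Import Defs.

(** Put [x = y - z], [N = ||xs - x||] and [e = z - F x + y]. Since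
    [F x - x = 2 z - e] and [F xs - xs = 2 xs^-], the uniform P-property at
    [(xs, x)] and complementarity of [xs^+] and [xs^-] give, for some
    coordinate [i], [N^beta <= 2 y^i z^i + N ||e||]. The bound on [G_r]
    together with [psi <= psi_1] yields
    [y^i z^i = O(r^2 + r^sigma (y^i + z^i))]. As [beta > 1], the two estimates
    first bound [N] and then give
    [N^beta <= O(r^min(2, sigma)) + O(r^gamma) N], hence the rate of [x_k];
    the rate of [y_k] follows from [|y - (y - z)^+| <= sqrt (y z)].
    Finally [F + I] is injective and maps [xs] to [2 xs^+], so
    [H(ys) = ys - xs]. *)

Set Implicit Arguments.
Unset Strict Implicit.

(** * Smoothing functions and the product bound they imply *)

Lemma smoothing_concave_le (R : realType) (theta : R -> R) (s a b : R) :
  smoothing_function theta -> 0 <= s <= 1 ->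
  s * theta a + (1 - s) * theta b <= theta (s * a + (1 - s) * b).
Proof.
move=> hth /andP[s0 s1].
have /(_ a b) := smoothing_concave hth (Itv01 s0 s1).
rewrite !inE => /(_ Logic.I Logic.I).
rewrite !convRE /= /unstable.onem.
lra.
Qed.

(** Concavity at [0], the convex combination of [t] and [-1] with weight [1 / (1 + t)] on [t], gives
    [theta t + t * theta (- 1) <= 0]. *)
Lemma smoothing_le_linear (R : realType) (theta : R -> R) (t : R) :
  smoothing_function theta -> 0 <= t -> theta t <= t * - theta (- 1).
Proof.
move=> hth t0.
have t1 : 0 < 1 + t by lra.
have s01 : 0 <= (1 + t)^-1 <= 1.
  by rewrite invr_ge0 ltW//= invf_le1//; lra.
have := smoothing_concave_le t (- 1) hth s01.
have -> : (1 + t)^-1 * t + (1 - (1 + t)^-1) * - 1 = 0 by field; lra.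
rewrite (smoothing_0 hth).
have -> : (1 + t)^-1 * theta t + (1 - (1 + t)^-1) * theta (- 1)
  = (theta t + t * theta (- 1)) / (1 + t) by field; lra.
by rewrite pmulr_lle0 ?invr_gt0//; lra.
Qed.

(** By concavity between [- T] and [0], [theta (- T) <= T * theta (- 1)] for [T >= 1]; the chosen
    [T] makes the right side [theta (- 1) - |c|]. *)
Lemma smoothing_unbounded_below (R : realType) (theta : R -> R) (c : R) :
  smoothing_function theta -> exists2 t, t <= 0 & theta t <= c.
Proof.
move=> hth; have m0 : theta (- 1) < 0 by apply: (smoothing_lt0 hth); lra.
set T := 1 + `|c| / - theta (- 1).
have q0 : 0 <= `|c| / - theta (- 1) by rewrite divr_ge0//; lra.
have T1 : 1 <= T by rewrite /T; lra.
exists (- T); first lra.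
have s01 : 0 <= T^-1 <= 1 by rewrite invr_ge0 invf_le1; lra.
have := smoothing_concave_le (- T) 0 hth s01.
rewrite (smoothing_0 hth) !mulr0 !addr0 mulrN mulVf; last lra.
rewrite ler_pdivrMl; last lra.
move=> /le_trans; apply; rewrite /T mulrDl mul1r invrN mulrN mulNr divfK; last lra.
by have := ler_norm (- c); rewrite normrN; lra.
Qed.

Lemma psi_decreasing (R : realType) (theta : R -> R) (s t : R) :
  smoothing_function theta -> (psi_of theta s < psi_of theta t) = (t < s).
Proof.
move=> hth; rewrite /psi_of ltrD2l ltrN2.
exact/leW_mono/le_mono/(smoothing_increasing hth).
Qed.

(** Intermediate values: [theta] falls below [1 - s] because it is unbounded below, and exceeds it
    because its limit is [1]. *)
Lemma psi_surjective (R : realType) (theta : R -> R) (s : R) :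
  smoothing_function theta -> 0 < s -> exists t, psi_of theta t = s.
Proof.
move=> hth s0.
have [b b0 hb] : exists2 b, 0 <= b & 1 - s <= theta b.
  have /cvgrPdist_le/(_ s s0) := smoothing_cvg hth.
  move=> [M [Mr hM]].
  have hm : M < Num.max (M + 1) 0 by rewrite lt_max; apply/orP; left; lra.
  exists (Num.max (M + 1) 0); first by rewrite le_max lexx orbT.
  have := hM _ hm; have := ler_norm (1 - theta (Num.max (M + 1) 0)) => /=.
  lra.
have [a a0 ha] := smoothing_unbounded_below (1 - s) hth.
have cth : continuous theta.
  move=> t; apply/differentiable_continuous/derivable1_diffP.
  exact: smoothing_derivable.
have [||c _ hc] := @IVT R theta a b (1 - s) (le_trans a0 b0).
- exact: continuous_subspaceT.
- by rewrite ge_min le_max ha hb orbT.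
- by exists c; rewrite /psi_of hc; lra.
Qed.

Lemma psi_pinv (R : realType) (theta : R -> R) (s : R) :
  smoothing_function theta -> 0 < s ->
  psi_of theta (pinv setT (psi_of theta) s) = s.
Proof.
move=> hth s0; apply: pinvK; rewrite inE.
by have [t ht] := psi_surjective hth s0; exists t.
Qed.

(* With [u = y / r], [v = z / r] and [c = psi (C r^(sigma - 1))], the bound on
   [G_r] gives [c <= psi u + psi v <= 1 / (1 + u) + 1 / (1 + v)], that is
   [c u v <= 2 - c + (1 - c) (u + v)]; moreover [c] is bounded away from 0 and
   [1 - c = O(r^(sigma - 1))] by concavity of [theta]. *)
Lemma Gr_le_product_bound (R : realType) (theta : R -> R) (C sigma : R) :
  smoothing_function theta -> (forall t, psi_of theta t <= psi_of theta1 t) ->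
  0 <= C -> 1 <= sigma ->
  exists2 D, 0 <= D & forall r y z : R, 0 < r <= 1 -> 0 <= y -> 0 <= z ->
    r * pinv setT (psi_of theta) (psi_of theta (y / r) + psi_of theta (z / r))
      <= C * r `^ sigma ->
    y * z <= D * (r ^+ 2 + r `^ sigma * (y + z)).
Proof.
move=> hth hle C0 sg1.
have c0 : 0 < psi_of theta C.
  by have := smoothing_lt1 hth C; rewrite /psi_of; lra.
have m0 : theta (- 1) < 0 by apply: (smoothing_lt0 hth); lra.
have C'0 : 0 <= C * - theta (- 1) by rewrite mulr_ge0//; lra.
(* The [2] comes from [2 r^2], [C * - theta (- 1)] from the linear bound on [theta t], and [psi C]
   is the lower bound for [psi t]. *)
exists ((2 + C * - theta (- 1)) / psi_of theta C).
  by rewrite divr_ge0//; lra.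
move=> r y z r01 y0 z0 hG.
have r0 : 0 < r by case/andP: r01.
set s := psi_of theta (y / r) + psi_of theta (z / r) in hG.
have s0 : 0 < s.
  rewrite /s /psi_of.
  have := smoothing_lt1 hth (y / r); have := smoothing_lt1 hth (z / r); lra.
set t := C * r `^ (sigma - 1).
have rE : r `^ sigma = r * r `^ (sigma - 1).
  rewrite -{2}(powRr1 (ltW r0)) -powRD; last by rewrite (gt_eqF r0) implybT.
  by rewrite addrC subrK.
have p0 : 0 <= r `^ (sigma - 1) by exact: powR_ge0.
have p1 : r `^ (sigma - 1) <= 1.
  by rewrite -[leRHS](powRr0 r); apply: ger_powR => //; lra.
have t0 : 0 <= t by rewrite mulr_ge0.
have tC : t <= C by rewrite ler_piMr.
have hs : psi_of theta t <= s.
  rewrite -(psi_pinv hth s0) leNgt psi_decreasing// -leNgt.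
  rewrite /t -(ler_pM2l r0).
  by apply: le_trans hG _; rewrite rE; lra.
have ct : psi_of theta C <= psi_of theta t.
  by rewrite leNgt psi_decreasing// -leNgt.
have tl : 1 - psi_of theta t <= C * - theta (- 1) * r `^ (sigma - 1).
  by have := smoothing_le_linear hth t0; rewrite /psi_of /t; lra.
have psi1E x : 0 <= x -> psi_of theta1 (x / r) = r / (r + x).
  move=> x0; rewrite /psi_of /theta1 divr_ge0//; last lra.
  by field; apply/andP; split; lra.
have hs1 : psi_of theta t <= r / (r + y) + r / (r + z).
  by rewrite -!psi1E//; apply: le_trans hs _; rewrite lerD.
have {hs1} : psi_of theta t * ((r + y) * (r + z)) <= r * (2 * r + y + z).
  have yz0 : 0 < (r + y) * (r + z) by rewrite mulr_gt0//; lra.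
  move: hs1; rewrite -(ler_pM2r yz0) => /le_trans -> //.
  by rewrite le_eqVlt; apply/orP/or_introl/eqP; field; apply/andP; split; lra.
set p := psi_of theta t in ct tl * => hp.
rewrite mulrAC ler_pdivlMr// mulrC.
have yz0 : 0 <= y * z by rewrite mulr_ge0.
have h1 : p * (y * z) <= 2 * r ^+ 2 + (1 - p) * (r * (y + z)).
  have : 0 <= p * r ^+ 2 by rewrite mulr_ge0 ?sqr_ge0//; lra.
  lra.
apply: (le_trans (ler_wpM2r yz0 ct)); apply: (le_trans h1).
have h2 : 0 <= r * (y + z) by rewrite mulr_ge0//; lra.
have := ler_wpM2r h2 tl.
have e0 : 0 <= r `^ sigma * (y + z) by rewrite mulr_ge0 ?powR_ge0//; lra.
have r20 : 0 <= C * - theta (- 1) * r ^+ 2 by rewrite mulr_ge0 ?sqr_ge0.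
move: e0; rewrite rE; lra.
Qed.

(** * Two scalar inequalities *)

(** The larger of [a] and [b * N] is at least half of the sum, so [N^beta <= 2 a] or
    [N^(beta - 1) <= 2 b]. *)
Lemma powR_le_affine_bound (R : realType) (beta a b N : R) :
  1 < beta -> 0 <= a -> 0 <= b -> 0 <= N -> N `^ beta <= a + b * N ->
  N <= (2 * a) `^ beta^-1 + (2 * b) `^ (beta - 1)^-1.
Proof.
move=> b1 a0 b0 N0 hN.
have inv (q x : R) : 0 < q -> N `^ q <= x -> N <= x `^ q^-1.
  move=> q0 hx; rewrite -(powRr1 N0) -(@mulfV _ q); last lra.
  rewrite powRrM; apply: ge0_ler_powR => //; rewrite ?nnegrE.
  - by rewrite invr_ge0 ltW.
  - exact: powR_ge0.
  - exact: le_trans (powR_ge0 _ _) hx.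
have p1 := powR_ge0 (2 * a) beta^-1.
have p2 := powR_ge0 (2 * b) (beta - 1)^-1.
have [hab|hab] := leP (b * N) a.
  suff : N <= (2 * a) `^ beta^-1 by lra.
  by apply: inv; lra.
suff : N <= (2 * b) `^ (beta - 1)^-1 by lra.
have Npos : 0 < N.
  rewrite lt_neqAle N0 andbT; apply: contraTneq hab => <-.
  by rewrite mulr0 -leNgt.
apply: inv; first lra.
rewrite -(ler_pM2l Npos) -{1}(powRr1 N0) -powRD; last by rewrite (gt_eqF Npos) implybT.
by rewrite addrC subrK; lra.
Qed.

(** The left side is [min(y, z)], whose square is at most [y z]. *)
Lemma subr_pospart_le_sqrt (R : realType) (y z : R) : 0 <= y -> 0 <= z ->
  `|y - Num.max (y - z) 0| <= Num.sqrt (y * z).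
Proof.
move=> y0 z0; have [h|h] := leP 0 (y - z); rewrite ?subr0.
  rewrite (_ : y - (y - z) = z); last lra.
  rewrite ger0_norm// -{1}(ger0_norm z0) -sqrtr_sqr ler_wsqrtr// expr2.
  by rewrite ler_wpM2r//; lra.
rewrite ger0_norm// -{1}(ger0_norm y0) -sqrtr_sqr ler_wsqrtr// expr2.
by rewrite ler_wpM2l//; lra.
Qed.

(** * Euclidean norm versus coordinates *)

Lemma enorm_ge0 (R : realType) (d : nat) (x : 'rV[R]_d) : 0 <= enorm x.
Proof. exact: sqrtr_ge0. Qed.

Lemma ler_coord_enorm (R : realType) (d : nat) (x : 'rV[R]_d) i :
  `|x 0 i| <= enorm x.
Proof.
rewrite -sqrtr_sqr ler_wsqrtr// (bigD1 i)//= lerDl.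
by apply: sumr_ge0 => j _; exact: sqr_ge0.
Qed.

Lemma enorm_le_coord (R : realType) (d : nat) (x : 'rV[R]_d) (c : R) :
  0 <= c -> (forall i, `|x 0 i| <= c) -> enorm x <= d%:R * c.
Proof.
move=> c0 hx; have dc0 : 0 <= d%:R * c by rewrite mulr_ge0.
rewrite -(ger0_norm dc0) -sqrtr_sqr ler_wsqrtr//.
have h : \sum_(i < d) x 0 i ^+ 2 <= \sum_(i < d) c ^+ 2.
  by apply: ler_sum => i _; rewrite -real_normK ?num_real// lerXn2r ?nnegrE.
apply: (le_trans h); rewrite sumr_const card_ord exprMn -[leLHS]mulr_natl.
rewrite ler_wpM2r ?sqr_ge0// -natrX ler_nat.
by case: d {x hx dc0 h} => // d; rewrite leq_pmulr.
Qed.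

(** Euclidean rates yield convergence in the sup-norm topology of row vectors, since each coordinate
    is bounded by [enorm]. *)
Lemma cvg_rowvec (R : realType) (d : nat) (u : nat -> 'rV[R]_d) (l : 'rV[R]_d)
    (e : nat -> R) :
  e k @[k --> \oo] --> (0 : R) ->
  (\forall k \near \oo, enorm (l - u k) <= e k) -> u k @[k --> \oo] --> l.
Proof.
move=> he hu; apply/cvg_ballP => eps eps0.
near=> k; split => // i j; rewrite ord1 /ball/=.
have := ler_coord_enorm (l - u k) j; rewrite !mxE => /le_lt_trans; apply.
apply: (@le_lt_trans _ _ (e k)); first by near: k.
apply: le_lt_trans (ler_norm _) _; rewrite -[e k]subr0 distrC.
by near: k; apply: cvgr_dist_lt.
Unshelve. all: by end_near. Qed.

(** * Uniform P-maps, the map [H] and the residual *)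

(** If every term were below [h], so would be the maximum; the empty family is covered by [-oo]
    being below any real. *)
Lemma uniform_P_map_coord (R : realType) (d : nat) (h : R -> R)
    (G : 'rV[R]_d -> 'rV[R]_d) (x y : 'rV[R]_d) :
  uniform_P_map h G ->
  exists i, h (enorm (x - y)) <= (x 0 i - y 0 i) * (G x 0 i - G y 0 i).
Proof.
move=> [_ /(_ x y) hP]; apply: contrapT => /forallNP hn; move: hP.
apply/negP; rewrite -ltNge; apply/bigmax_ltP; split; first exact: ltNyr.
by move=> i _; rewrite lte_fin ltNge; exact/negP.
Qed.

Lemma enorm_eq0 (R : realType) (d : nat) (x : 'rV[R]_d) : enorm x = 0 -> x = 0.
Proof.
move=> x0; apply/rowP => i; rewrite mxE; apply/eqP.
by rewrite -normr_le0 -x0 ler_coord_enorm.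
Qed.

(** Equal images under [F + I] turn each product into [-2 (x^i - y^i)^2 <= 0], whereas [h] is
    positive at a nonzero distance. *)
Lemma uniform_P_map_addid_inj (R : realType) (d : nat) (h : R -> R)
    (F : 'rV[R]_d -> 'rV[R]_d) :
  uniform_P_map h (fun x => F x - x) -> injective (fun x => F x + x).
Proof.
move=> hP x y hxy; apply/eqP; rewrite -subr_eq0; apply/eqP/enorm_eq0.
have [i hi] := uniform_P_map_coord x y hP.
have [[_ hpos] _] := hP.
apply/eqP; rewrite eq_le enorm_ge0 andbT leNgt; apply/negP => /hpos.
move/(congr1 (fun v : 'rV[R]_d => v 0 i)): hxy; rewrite !mxE => hxyi.
move: hi; rewrite !mxE.
have -> : (x 0 i - y 0 i) * (F x 0 i - x 0 i - (F y 0 i - y 0 i))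
        = (- 2) * (x 0 i - y 0 i) ^+ 2.
  have -> : F x 0 i = F y 0 i + y 0 i - x 0 i by rewrite -hxyi; ring.
  ring.
have := sqr_ge0 (x 0 i - y 0 i); lra.
Qed.

Lemma Hmap_posv (R : realType) (d : nat) (h : R -> R)
    (F : 'rV[R]_d -> 'rV[R]_d) (x : 'rV[R]_d) :
  uniform_P_map h (fun x => F x - x) -> F x = absv x ->
  Hmap F (posv x) = posv x - x.
Proof.
move=> hP hx; rewrite /Hmap; congr (_ - _).
have -> : 2 *: posv x = F x + x.
  apply/rowP => i; rewrite hx !mxE.
  by have [a0|a0] := leP 0 (x 0 i); [rewrite ger0_norm|rewrite ltr0_norm]; lra.
apply: (@pinvKV _ _ (fun=> point) setT (fun x : 'rV[R]_d => F x + x));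
  rewrite ?inE//.
by move=> u v _ _; exact: (uniform_P_map_addid_inj hP).
Qed.

(* For [x = y - z] and [F xs = |xs|], a coordinate realising the uniform
   P-property satisfies [2 Y Z - 2 Z^2 + (Y - Z) e >= N^beta], where
   [Y = y - ys], [Z = z - zs], and [Y Z <= y z] since [ys zs = 0]. *)
Lemma residual_bound (R : realType) (d : nat) (h : R -> R)
    (F : 'rV[R]_d -> 'rV[R]_d) (xs y z : 'rV[R]_d) (e : R) :
  uniform_P_map h (fun x => F x - x) -> F xs = absv xs ->
  nonneg y -> nonneg z -> enorm (z - F (y - z) + y) <= e ->
  exists i, h (enorm (xs - (y - z)))
    <= 2 * (y 0 i * z 0 i) + e * enorm (xs - (y - z)).
Proof.
move=> hP hxs y0 z0 he.
have [i hi] := uniform_P_map_coord xs (y - z) hP.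
exists i; apply: (le_trans hi); rewrite hxs !mxE.
have := ler_coord_enorm (xs - (y - z)) i.
have := ler_coord_enorm (z - F (y - z) + y) i.
rewrite !mxE; set N := enorm (xs - (y - z)); set f := F (y - z) 0 i.
move=> /le_trans/(_ he).
move: (y0 i) (z0 i); set a := y 0 i; set b := z 0 i => a0 b0.
set w := z 0 i - f + y 0 i => hw hN.
have hwN : `|xs 0 i - (a - b)| * `|w| <= e * N by rewrite mulrC ler_pM.
have := ler_norm ((xs 0 i - (a - b)) * w); rewrite normrM.
move=> /le_trans/(_ hwN); rewrite /w -/a -/b => {}hwN.
(* Since [f = a + b - w], the part without [w] is [2ab - 2b^2 - 2 xs^i b] if [xs^i >= 0], and
   [2ab - 2(b + xs^i)^2 + 2 xs^i a] otherwise; all terms but [2ab] are nonpositive. *)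
have [p0|p0] := leP 0 (xs 0 i); [rewrite ger0_norm//|rewrite ltr0_norm//].
  have := sqr_ge0 b; have := mulr_ge0 p0 b0; lra.
have n0 : 0 <= - xs 0 i by lra.
have := sqr_ge0 (b + xs 0 i); have := mulr_ge0 n0 a0; lra.
Qed.

(** * Rates with explicit constants *)

Lemma pospart_nonexpansive (R : realType) (a b : R) :
  `|Num.max a 0 - Num.max b 0| <= `|a - b|.
Proof.
have := ler_norm (a - b); have := ler_norm (- (a - b)).
by rewrite normrN ler_norml; case: (leP 0 a); case: (leP 0 b); lra.
Qed.

(** With [S = y + z], the hypotheses give [S^2 <= X^2 + 4 D (1 + S)], which fails once
    [S > X + 4 D + 1]. *)
Lemma sum_le_of_product_le (R : realType) (y z X D : R) :
  0 <= y -> 0 <= z -> 0 <= D -> 0 <= X -> `|y - z| <= X ->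
  y * z <= D * (1 + (y + z)) -> y + z <= X + 4 * D + 1.
Proof.
move=> y0 z0 D0 X0 hX hyz; rewrite leNgt; apply/negP => hS.
have : (y - z) ^+ 2 <= X ^+ 2.
  by rewrite -real_normK ?num_real// lerXn2r ?nnegrE.
have h1 : 0 <= (y + z - 4 * D - X - 1) * (y + z) by rewrite mulr_ge0//; lra.
have h2 : 0 <= X * (y + z - X - 4 * D - 1) by rewrite mulr_ge0//; lra.
have h3 : 0 <= X * D by rewrite mulr_ge0.
lra.
Qed.

(* The a priori bound on [y + z] comes from [(y + z)^2 = (y - z)^2 + 4 y z];
   inserting it in the residual bound gives [N^beta <= O(1) + O(1) N], so that
   [N] is bounded, whence all error terms but [rho^gamma N] are
   [O(rho^min(2, sigma))]. *)
Lemma product_and_residual_rate (R : realType) (d : nat) (h : R -> R)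
    (F : 'rV[R]_d -> 'rV[R]_d) (theta : R -> R) (xs : 'rV[R]_d)
    (C1 C2 gamma sigma beta : R) :
  smoothing_function theta -> (forall t, psi_of theta t <= psi_of theta1 t) ->
  uniform_P_map h (fun x => F x - x) ->
  (forall t, 0 <= t -> t `^ beta <= h t) -> F xs = absv xs ->
  0 <= C1 -> 0 <= C2 -> 1 <= gamma -> 1 <= sigma -> 1 < beta ->
  exists2 K, 0 <= K & forall (rho : R) (y z : 'rV[R]_d),
    0 < rho <= 1 -> nonneg y -> nonneg z ->
    enorm (z - F (y - z) + y) <= C1 * rho `^ gamma ->
    (forall i, Gr theta rho y z 0 i <= C2 * rho `^ sigma) ->
    (forall i, y 0 i * z 0 i <= K * rho `^ Num.min 2 sigma) /\
    enorm (xs - (y - z)) `^ beta <= K * rho `^ Num.min 2 sigma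
      + C1 * rho `^ gamma * enorm (xs - (y - z)).
Proof.
move=> hth hle hP hh hxs C10 C20 g1 s1 b1.
have [D D0 hD] := Gr_le_product_bound hth hle C20 s1.
set M := enorm xs; have M0 : 0 <= M := enorm_ge0 xs.
(* Chosen so that [y^i + z^i <= M + N + 4 D + 1] turns the product bound into [L P + D P N]. *)
set L := D * (M + 4 * D + 2).
have L0 : 0 <= L by rewrite mulr_ge0//; lra.
(* Bound on [N] obtained from [N^beta <= 2 L + (2 D + C1) N], where all powers of [rho] are
   estimated by [1]. *)
set N0 := (2 * (2 * L)) `^ beta^-1 + (2 * (2 * D + C1)) `^ (beta - 1)^-1.
have N00 : 0 <= N0 by rewrite addr_ge0 ?powR_ge0.
have DN0 : 0 <= D * N0 by rewrite mulr_ge0.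
exists (2 * (L + D * N0)); first lra.
move=> rho y z r01 y0 z0 hres hGr.
set N := enorm (xs - (y - z)); have Nge0 : 0 <= N := enorm_ge0 _.
have pow1 q : 0 <= q -> rho `^ q <= 1.
  by move=> q0; rewrite -[leRHS](powRr0 rho); exact: ger_powR.
set P := rho `^ Num.min 2 sigma.
have P0 : 0 <= P := powR_ge0 _ _.
have P1 : P <= 1 by apply: pow1; rewrite le_min; apply/andP; split; lra.
have r2P : rho ^+ 2 <= P.
  rewrite -powR_mulrn; last by case/andP: r01 => /ltW.
  by apply: ger_powR => //; rewrite ge_min lexx.
have rsP : rho `^ sigma <= P by apply: ger_powR => //; rewrite ge_min lexx orbT.
have prod i : y 0 i * z 0 i <= L * P + D * P * N.
  have hi := hGr i; rewrite /Gr mxE in hi.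
  have := hD rho (y 0 i) (z 0 i) r01 (y0 i) (z0 i) hi.
  move: (y0 i) (z0 i); set a := y 0 i; set b := z 0 i => a0 b0 hab.
  have hX : `|a - b| <= M + N.
    have := ler_coord_enorm xs i; have := ler_coord_enorm (xs - (y - z)) i.
    rewrite !mxE -/a -/b -/M -/N.
    have := ler_normB (xs 0 i) (xs 0 i - (a - b)).
    by rewrite (_ : xs 0 i - (xs 0 i - (a - b)) = a - b); [lra|ring].
  have hab' : a * b <= D * (P * (1 + (a + b))).
    apply: (le_trans hab); rewrite ler_wpM2l//.
    have ab0 : 0 <= a + b by lra.
    have := ler_wpM2r ab0 rsP; lra.
  have hS : a + b <= M + N + 4 * D + 1.
    apply: sum_le_of_product_le => //; first lra.
    apply: (le_trans hab'); rewrite ler_wpM2l// ler_piMl//; lra.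
  apply: (le_trans hab').
  have DP0 : 0 <= D * P by rewrite mulr_ge0.
  have := ler_wpM2l DP0 hS; rewrite /L; lra.
have [i hi] := residual_bound hP hxs y0 z0 hres.
rewrite -/N in hi; have {}hi := le_trans (hh _ Nge0) hi.
have LP : L * P <= L by rewrite ler_piMr.
have DNP : D * N * P <= D * N by rewrite ler_piMr// mulr_ge0.
have C1N : C1 * rho `^ gamma * N <= C1 * N.
  by rewrite ler_wpM2r// ler_piMr// pow1//; lra.
have hN : N <= N0.
  apply: powR_le_affine_bound => //; try lra.
  apply: (le_trans hi); have := prod i; lra.
have DPN : D * P * N <= D * N0 * P.
  by rewrite mulrAC ler_wpM2r// ler_wpM2l.
have LP0 : 0 <= L * P by rewrite mulr_ge0.
have DNP0 : 0 <= D * N0 * P by rewrite mulr_ge0.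
split=> [j|]; first by have := prod j; lra.
by apply: (le_trans hi); have := prod i; lra.
Qed.

Lemma smoothing_rate (R : realType) (d : nat) (h : R -> R)
    (F : 'rV[R]_d -> 'rV[R]_d) (theta : R -> R) (xs : 'rV[R]_d)
    (C1 C2 gamma sigma beta : R) :
  let ts := Num.min (Num.min 2 sigma) (gamma / (beta - 1)) in
  let alpha := Num.min (ts / beta) (ts / 2) in
  smoothing_function theta -> (forall t, psi_of theta t <= psi_of theta1 t) ->
  uniform_P_map h (fun x => F x - x) ->
  (forall t, 0 <= t -> t `^ beta <= h t) -> F xs = absv xs ->
  0 <= C1 -> 0 <= C2 -> 1 <= gamma -> 1 <= sigma -> 1 < beta ->
  exists2 K, 0 <= K & forall (rho : R) (y z : 'rV[R]_d),
    0 < rho <= 1 -> nonneg y -> nonneg z ->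
    enorm (z - F (y - z) + y) <= C1 * rho `^ gamma ->
    (forall i, Gr theta rho y z 0 i <= C2 * rho `^ sigma) ->
    enorm (xs - (y - z)) <= K * rho `^ (ts / beta) /\
    enorm (posv xs - y) <= K * rho `^ alpha.
Proof.
move=> ts alpha hth hle hP hh hxs C10 C20 g1 s1 b1.
have [K K0 hK] :=
  product_and_residual_rate hth hle hP hh hxs C10 C20 g1 s1 b1.
have ts0 : 0 <= ts.
  by rewrite !le_min divr_ge0; [rewrite andbT; apply/andP; split| |]; lra.
set A := (2 * K) `^ beta^-1 + (2 * C1) `^ (beta - 1)^-1.
have A0 : 0 <= A by rewrite addr_ge0 ?powR_ge0.
have B0 : 0 <= A + Num.sqrt K by rewrite addr_ge0 ?sqrtr_ge0.
(* [A] serves for [x], and [d (A + sqrt K)] for [y], with [d] from the passage from coordinates to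
   the norm. *)
exists (A + d%:R * (A + Num.sqrt K)); first by rewrite addr_ge0 ?mulr_ge0.
move=> rho y z r01 y0 z0 hres hGr.
have [hprod hN] := hK rho y z r01 y0 z0 hres hGr.
have r0 : 0 <= rho by case/andP: r01 => /ltW.
set T := rho `^ (ts / beta).
have T0 : 0 <= T := powR_ge0 _ _.
have rate : enorm (xs - (y - z)) <= A * T.
  have := powR_le_affine_bound b1 _ _ (enorm_ge0 _) hN.
  move=> /(_ (mulr_ge0 K0 (powR_ge0 _ _)) (mulr_ge0 C10 (powR_ge0 _ _))).
  move=> /le_trans; apply; rewrite !mulrA [A * T]mulrDl; apply: lerD.
    rewrite powRM ?mulr_ge0 ?powR_ge0// -powRrM ler_wpM2l ?powR_ge0//.
    apply: ger_powR => //; apply: ler_wpM2r; first by rewrite invr_ge0; lra.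
    by rewrite /ts ge_min lexx.
  rewrite powRM ?mulr_ge0 ?powR_ge0// -powRrM ler_wpM2l ?powR_ge0//.
  (* As [beta > 1] and [ts >= 0], [ts / beta <= ts <= gamma / (beta - 1)]. *)
  apply: ger_powR => //; apply: (@le_trans _ _ ts); last first.
    by rewrite /ts ge_min lexx orbT.
  by rewrite ler_pdivrMr ?ler_peMr//; lra.
set Q := rho `^ alpha.
have Q0 : 0 <= Q := powR_ge0 _ _.
have TQ : T <= Q by apply: ger_powR => //; rewrite ge_min lexx.
(* Compare both with [(y - z)^+]: nonexpansiveness gives the rate of [x], and [sqrt (y z)] the
   exponent [min(2, sigma) / 2 >= ts / 2]. *)
have coord i : `|(posv xs - y) 0 i| <= (A + Num.sqrt K) * Q.
  rewrite !mxE.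
  have h1 : `|Num.max (xs 0 i) 0 - Num.max (y 0 i - z 0 i) 0| <= A * Q.
    apply: (@le_trans _ _ (A * T)); last by rewrite ler_wpM2l.
    apply: le_trans rate; have := ler_coord_enorm (xs - (y - z)) i.
    by rewrite !mxE; apply: le_trans; exact: pospart_nonexpansive.
  have h2 : `|y 0 i - Num.max (y 0 i - z 0 i) 0| <= Num.sqrt K * Q.
    apply: (le_trans (subr_pospart_le_sqrt (y0 i) (z0 i))).
    apply: (le_trans (ler_wsqrtr (hprod i))); rewrite sqrtrM//.
    rewrite ler_wpM2l ?sqrtr_ge0// -powR12_sqrt ?powR_ge0// -powRrM.
    apply: ger_powR => //; rewrite ge_min; apply/orP; right.
    by rewrite ler_wpM2r ?invr_ge0// ge_min lexx.
  set m := Num.max (y 0 i - z 0 i) 0 in h1 h2.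
  have := ler_normB (Num.max (xs 0 i) 0 - m) (y 0 i - m).
  rewrite (_ : _ - _ - (_ - _) = Num.max (xs 0 i) 0 - y 0 i); [lra|ring].
split.
  by apply: (le_trans rate); rewrite ler_wpM2r// lerDl mulr_ge0.
have := enorm_le_coord (mulr_ge0 B0 Q0) coord.
by move=> /le_trans; apply; rewrite mulrA ler_wpM2r// lerDr.
Qed.

(** * Passage to sequences and conclusion *)

Lemma eqO_le (R : realType) (f : nat -> R) (g : nat -> R) (K : R) :
  (\forall k \near \oo, `|f k| <= K * g k) -> f =O_\oo g.
Proof.
move=> hf; apply/eqO_exP; exists (`|K| + 1); first by rewrite ltr_pwDr.
apply: filterS hf => k /le_trans; apply.
rewrite mulrDl mul1r; apply: (le_trans (ler_norm _)).
by rewrite normrM lerDl.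
Qed.

Theorem theorem3p8 (R : realType) (d : nat) (F : 'rV[R]_d -> 'rV[R]_d)
  (theta : R -> R) (r : nat -> R) (y z : nat -> 'rV[R]_d)
  (gamma sigma beta : R) (h : R -> R) (xs : 'rV[R]_d)
  (hFa : assumption_a F)
  (hthetab : assumption_b theta)
  (hseqc : assumption_c F theta r y z gamma sigma)
  (hFcont : continuous F)
  (hFP : uniform_P_map h (fun x => F x - x))
  (hbeta : 1 < beta)
  (hh : forall t, 0 <= t -> t `^ beta <= h t)
  (hxs : F xs = absv xs) :
  let ys := posv xs in
  let H := Hmap F in
  let x := fun k => y k - z k in
  let tsigma := Num.min (Num.min 2 sigma) (gamma / (beta - 1)) in
  let alpha := Num.min (tsigma / beta) (tsigma / 2) in
  [/\ H ys = F (ys - H ys) - ys /\ complementary ys (H ys),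
      y k @[k --> \oo] --> ys /\ z k @[k --> \oo] --> H ys,
      x k @[k --> \oo] --> xs /\ xs = ys - H ys,
      (fun k => enorm (ys - y k)) =O_\oo (fun k => r k `^ alpha) &
      (fun k => enorm (xs - x k)) =O_\oo (fun k => r k `^ (tsigma / beta))].
Proof.
move=> ys H x tsigma alpha.
have hHys : H ys = ys - xs by exact: Hmap_posv hFP hxs.
have [rpos rcvg y0 z0 gamma1 sigma1 [e1 [hO1 he1]] [e2 [hO2 he2]]] := hseqc.
have [hth hle _] := hthetab.
have [C1 C10 hC1] := (eqO_exP _ _ _).1 hO1.
(* Each coordinate of [e2] has its own constant; their sum [C2] serves all coordinates at once. *)
pose c i := projT1 (cid2 ((eqO_exP _ _ _).1 (hO2 i))).
have c0 i : 0 <= c i by rewrite /c; case: cid2 => //= ? /ltW.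
have hc i : \forall k \near \oo, `|e2 k 0 i| <= c i * `|r k `^ sigma|.
  by rewrite /c; case: cid2.
pose C2 := \sum_i c i.
have C20 : 0 <= C2 by apply: sumr_ge0.
have [K K0 hK] :=
  smoothing_rate hth hle hFP hh hxs (ltW C10) C20 gamma1 sigma1 hbeta.
have near_r1 : \forall k \near \oo, r k <= 1.
  have /cvgrPdist_le/(_ 1 ltr01) := rcvg; apply: filterS => k.
  by rewrite sub0r normrN gtr0_norm.
have near_c : \forall k \near \oo, forall i, Gr theta (r k) (y k) (z k) 0 i
    <= C2 * r k `^ sigma.
  apply: filter_forall => i; apply: filterS (hc i) => k hk.
  apply: (le_trans (he2 k i)); apply: (le_trans (ler_norm _)).
  apply: (le_trans hk); rewrite ger0_norm ?powR_ge0// ler_wpM2r ?powR_ge0//.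
  by rewrite /C2 (bigD1 i)//= lerDl sumr_ge0.
have main : \forall k \near \oo, enorm (xs - x k) <= K * r k `^ (tsigma / beta)
    /\ enorm (ys - y k) <= K * r k `^ alpha.
  near=> k; apply: hK => //.
  - by rewrite rpos; near: k.
  - apply: (le_trans (he1 k)); apply: (le_trans (ler_norm _)).
    by rewrite -[_ `^ _]ger0_norm ?powR_ge0//; near: k.
  - by near: k.
have ts0 : 0 < tsigma.
  by rewrite !lt_min divr_gt0; [rewrite andbT; apply/andP; split| |]; lra.
have pow_cvg q : 0 < q -> K * r k `^ q @[k --> \oo] --> (0 : R).
  move=> q0; rewrite -[X in _ --> X](mulr0 K); apply: cvgM; first exact: cvg_cst.
  (* The power tends to [0] along the right-sided filter at [0], which [r] enters because it is
     positive. *)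
  apply: (@cvg_comp _ _ _ r (fun a => a `^ q) _ 0^'+); last exact: powR_cvg0.
  move=> /= B [eps /= eps0 hB].
  have /cvgrPdist_lt/(_ eps eps0) := rcvg; apply: filterS => k hk.
  exact: hB.
have tb0 : 0 < tsigma / beta by rewrite divr_gt0//; lra.
have alpha0 : 0 < alpha by rewrite lt_min tb0 divr_gt0.
have ycvg : y k @[k --> \oo] --> ys.
  by apply: (cvg_rowvec (pow_cvg _ alpha0)); apply: filterS main => k [].
have xcvg : x k @[k --> \oo] --> xs.
  by apply: (cvg_rowvec (pow_cvg _ tb0)); apply: filterS main => k [].
split.
- rewrite hHys subKr hxs; split.
    apply/rowP => i; rewrite !mxE.
    by case: (leP 0 (xs 0 i)) => ?; [rewrite ger0_norm|rewrite ltr0_norm]; lra.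
  split=> i; rewrite !mxE; first by rewrite le_max lexx orbT.
    by case: (leP 0 (xs 0 i)) => ?; lra.
  by case: (leP 0 (xs 0 i)) => ?; ring.
- split=> //; rewrite hHys.
  rewrite (_ : z = fun k => y k - x k); last by apply/funext => k; rewrite /x subKr.
  exact: cvgB.
- by rewrite hHys subKr.
- by apply: eqO_le (K) _; apply: filterS main => k [_];
    rewrite (ger0_norm (enorm_ge0 _)).
- by apply: eqO_le (K) _; apply: filterS main => k [+ _];
    rewrite (ger0_norm (enorm_ge0 _)).
Unshelve. all: by end_near. Qed.
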